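(* Let $X>0$ denote the (unbiased) gap length with $\mathbb{E}[X]=1/\lambda$ and coefficient of variation $\mathrm{CV}=\sqrt{\mathrm{Var}(X)}/\mathbb{E}[X]$. Let $X^*$ denote the length-biased gap length faced by a uniformly drawn task. Then $$\mathbb{E}[X^*]=\frac{\mathbb{E}[X^2]}{\mathbb{E}[X]}=\mathbb{E}[X]\,(1+\mathrm{CV}^2)=\frac{1+\mathrm{CV}^2}{\lambda}.$$ Consequently, $$\mathbb{E}[\sigma^2(x)]=\frac{\mathbb{E}[X^*]}{6}=\frac{1+\mathrm{CV}^2}{6\lambda}.$$
   Context: $X$ is the length of the gap between adjacent knowledge points on a line, with an arbitrary distribution on $(0,\infty)$ with finite variance. The length-biased gap $X^*$ has law $\Pr(X^*\in A)=\mathbb{E}[X\,\mathbf{1}\{X\in A\}]/\mathbb{E}[X]$ for measurable $A$. The local posterior variance at a uniformly drawn task is $\sigma^2(x)=X^*\,t(1-t)$, where $t\sim\mathrm{Uniform}(0,1)$ is the relative position in the gap, independent of $X^*$ (Brownian-bridge variance). *)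

(* Defs.v *)
From HB Require Import structures.
From mathcomp Require Import all_boot all_order all_algebra.
From mathcomp Require Import all_classical all_reals all_analysis.

Set Implicit Arguments.
Unset Strict Implicit.
Unset Printing Implicit Defensive.

Import Order.TTheory GRing.Theory Num.Theory.

Local Open Scope classical_set_scope.
Local Open Scope ring_scope.

(* The library's variance and expectation are extended reals; [fine] is
   harmless wherever they are finite. *)
Definition coef_variation d (T : measurableType d) (R : realType)
    (P : probability T R) (X : {RV P >-> R}) : R :=
  Num.sqrt (fine 'V_P[X]) / fine 'E_P[X].

(* Extended-real division: x / 0 = +oo for 0 < x, so this is a probability law
   only when X >= 0 and 0 < 'E_P[X] < +oo. *)
Definition length_biased_law d (T : measurableType d) (R : realType)
    (P : probability T R) (X : {RV P >-> R}) (A : set R) : \bar R :=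
  ('E_P[(fun w => X w * \1_A (X w))%R] / 'E_P[X])%E.

(* Xs may live on a probability space other than that of X: only its law is
   prescribed. *)
Definition is_length_biased d (T : measurableType d) d' (U : measurableType d')
    (R : realType) (P : probability T R) (X : {RV P >-> R})
    (Q : probability U R) (Xs : {RV Q >-> R}) : Prop :=
  forall A : set R, measurable A -> distribution Q Xs A = length_biased_law X A.

Definition is_uniform01 d (T : measurableType d) (R : realType)
    (P : probability T R) (t : {RV P >-> R}) : Prop :=
  forall A : set R, measurable A ->
    distribution P t A = uniform_prob (@ltr01 R) A.

Definition independent_RV2 d (T : measurableType d) (R : realType)
    (P : probability T R) (Y Z : {RV P >-> R}) : Prop :=
  forall A B : set R, measurable A -> measurable B ->
    P (Y @^-1` A `&` Z @^-1` B) = (P (Y @^-1` A) * P (Z @^-1` B))%E.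

(* Variance of a Brownian bridge over a gap of length Xs, at relative position
   t in the gap. *)
Definition local_posterior_variance d (T : measurableType d) (R : realType)
    (P : probability T R) (Xs t : {RV P >-> R}) (w : T) : R :=
  Xs w * (t w * (1 - t w)).

(* Main.v *)
(* The law of X^* has density x / E[X] with respect to the law of X, so E[X^*]
   is E[X * X] / E[X], and E[X^2] = Var(X) + E[X]^2 gives the formulas with CV.
   By independence the joint law of (X^*, t) is a product measure, so Tonelli
   factors E[X^* t (1 - t)], where the integral of t (1 - t) over [0, 1] is 1/6.
   Integrands are replaced by their absolute values, to which they are almost
   surely equal, so that only integrals of nonnegative functions occur. *)
Require Import Defs.
From HB Require Import structures.
From mathcomp Require Import all_boot all_order all_algebra.
From mathcomp Require Import all_classical all_reals all_analysis.
From mathcomp Require Import measurable_realfun.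
From mathcomp Require Import ring.

Set Implicit Arguments.
Unset Strict Implicit.
Unset Printing Implicit Defensive.

Import Order.TTheory GRing.Theory Num.Theory.
Import numFieldNormedType.Exports.

Local Open Scope classical_set_scope.
Local Open Scope ring_scope.
Local Open Scope ereal_scope.

(** * Integration against a measure given by a density *)

Section density.
Context d (T : measurableType d) (R : realType).
Variables (mu nu : {measure set T -> \bar R}) (h : T -> R).
Hypotheses (mh : measurable_fun setT h) (h0 : forall x, (0 <= h x)%R).
Hypothesis nuE : forall A, measurable A -> nu A = \int[mu]_(x in A) (h x)%:E.

Import HBNNSimple.

(** Both sides are linear in [f], which reduces the claim to indicators of level sets of [f], where
    it is [nuE]. *)
Let integral_density_nnsfun (f : {nnsfun T >-> R}) :
  \int[nu]_x (f x)%:E = \int[mu]_x ((f x)%:E * (h x)%:E).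
Proof.
under [LHS]eq_integral do rewrite fimfunE -fsumEFin//.
rewrite ge0_integral_fsum//; last 2 first.
  - by move=> r; exact/measurable_EFinP/measurableT_comp.
  - by move=> n x _; rewrite EFinM nnfun_muleindic_ge0.
under [RHS]eq_integral.
  move=> x _; rewrite fimfunE -fsumEFin// ge0_mule_fsuml; last first.
    by move=> r; rewrite EFinM nnfun_muleindic_ge0.
  over.
rewrite [RHS]ge0_integral_fsum//; last 2 first.
  - move=> r; apply: emeasurable_funM; last exact/measurable_EFinP.
    exact/measurable_EFinP/measurableT_comp.
  - move=> r x _; apply: mule_ge0; rewrite ?lee_fin//.
    by rewrite -lee_fin EFinM nnfun_muleindic_ge0.
apply: eq_fsbigr => r _.
rewrite integralZl_indic_nnsfun//= integral_indic// setIT nuE//.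
(* Only [r >= 0] can contribute: the level set of the nonnegative [f] at a negative [r] is empty, so
   both sides vanish there. *)
have [r0|r0] := leP 0%R r.
  under [RHS]eq_integral do rewrite EFinM -muleA.
  rewrite ge0_integralZl//; last 2 first.
    - apply: emeasurable_funM; last exact/measurable_EFinP.
      exact/measurable_EFinP.
    - by move=> x _; rewrite mule_ge0 ?lee_fin.
  congr (_ * _); rewrite integral_mkcond/=; apply: eq_integral => x _.
  by rewrite patchE indicE; case: ifPn => _; rewrite ?mul1e ?mul0e.
have -> : f @^-1` [set r] = set0.
  by apply/seteqP; split => // x /= fxr; move: r0; rewrite -fxr ltNge fun_ge0.
rewrite integral_set0 mule0; apply/esym/integral0_eq => x _.
by rewrite indic0 mulr0 mul0e.
Qed.

(** Monotone convergence on both sides along an increasing sequence of simple functions; since [h]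
    is nonnegative, multiplying by it preserves monotonicity. *)
Lemma ge0_integral_density (f : T -> \bar R) :
    measurable_fun setT f -> (forall x, 0 <= f x) ->
  \int[nu]_x f x = \int[mu]_x (f x * (h x)%:E).
Proof.
move=> mf f0; pose f_ := nnsfun_approx measurableT mf.
have f_lim x : (f_ n x)%:E @[n --> \oo] --> f x by exact: cvg_nnsfun_approx.
have f_nd x : nondecreasing_seq (fun n => (f_ n x)%:E).
  by move=> m n mn; rewrite lee_fin; exact/lefP/nd_nnsfun_approx.
transitivity (limn (fun n => \int[nu]_x (f_ n x)%:E)).
  rewrite -monotone_convergence//=.
  - by apply: eq_integral => x _; apply/esym/cvg_lim.
  - by move=> n; exact/measurable_EFinP.
  - by move=> n x _; rewrite lee_fin.
transitivity (limn (fun n => \int[mu]_x ((f_ n x)%:E * (h x)%:E))).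
  by apply: congr_lim; apply/funext => n; exact: integral_density_nnsfun.
rewrite -monotone_convergence//=.
- apply: eq_integral => x _; apply/cvg_lim => //.
  exact: cvgeZr (f_lim x).
- by move=> n; apply: emeasurable_funM; exact/measurable_EFinP.
- by move=> n x _; rewrite mule_ge0 ?lee_fin.
- by move=> x _ m n mn; rewrite lee_wpmul2r ?lee_fin//; exact: f_nd.
Qed.

End density.

(** * Independence and product measures *)

Section independence.
Context d (T : measurableType d) (R : realType).
Variables (P : probability T R) (Y Z : {RV P >-> R}).
Hypothesis YZ : independent_RV2 Y Z.

(** Independence says that the law of the pair agrees with the product measure on rectangles, hence
    everywhere by uniqueness; Tonelli then splits the integral. *)
Lemma ge0_integralM_independent (f g : R -> \bar R) :
    measurable_fun setT f -> measurable_fun setT g ->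
    (forall x, 0 <= f x) -> (forall x, 0 <= g x) ->
  \int[P]_w (f (Y w) * g (Z w)) =
  \int[distribution P Y]_x f x * \int[distribution P Z]_x g x.
Proof.
move=> mf mg f0 g0.
pose YZw w := (Y w, Z w).
have mYZ : measurable_fun setT YZw by exact: measurable_fun_pair.
pose F (z : R * R) := f z.1 * g z.2.
have mF : measurable_fun setT F.
  by apply: emeasurable_funM; exact: measurableT_comp.
have F0 z : 0 <= F z by rewrite mule_ge0.
(* The pair is packaged as a measurable map so that [distribution] applies to it. *)
pose YZm : {mfun T >-> (R * R)%type} :=
  HB.pack_for {mfun T >-> (R * R)%type} YZw
    (isMeasurableFun.Build _ _ _ _ _ mYZ).
transitivity (\int[distribution P YZm]_z F z).
  by rewrite ge0_integral_distribution.
transitivity (\int[distribution P Y \x distribution P Z]_z F z).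
  apply: eq_measure_integral => A mA _; apply/esym.
  by apply: product_measure_unique => // B C mB mC; exact: YZ.
rewrite fubini_tonelli1//=.
under eq_integral do rewrite /fubini_F /F/= ge0_integralZl//.
rewrite ge0_integralZr//.
exact: integral_ge0.
Qed.

End independence.

(** * The Brownian-bridge factor *)

Lemma integral_uniform01_bridge (R : realType) :
  \int[uniform_prob (@ltr01 R)]_x `|x * (1 - x)|%:E = 6^-1%:E :> \bar R.
Proof.
rewrite integral_uniform//; last first.
  apply/measurable_EFinP/measurableT_comp => //.
  by apply: measurable_funM => //; exact: measurable_funB.
rewrite subr0 invr1 mul1e.
(* [p] is the antiderivative of x(1 - x) vanishing at 0, and p(1) = 1/2 - 1/3 = 1/6. *)
pose p : {poly R} := (2^-1 *: 'X^2 - 3^-1 *: 'X^3)%R.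
have p'E x : (p^`()).[x] = (x * (1 - x))%R.
  by rewrite /p !poly.derivE !hornerE/=; field.
under eq_integral => x.
  rewrite inE/= in_itv/= => /andP[x0 x1].
  rewrite ger0_norm ?mulr_ge0 ?subr_ge0// -p'E.
  over.
rewrite (@continuous_FTC2 _ _ (horner p))//.
- rewrite -EFinB /p !hornerE/=; congr _%:E; by field.
- by apply: continuous_subspaceT => x; exact: continuous_horner.
- split.
  + by move=> x _; exact: derivable_horner.
  + exact/cvg_at_right_filter/continuous_horner.
  + exact/cvg_at_left_filter/continuous_horner.
- by move=> x _; rewrite -derivE.
Qed.

(** * Almost sure properties and expectations *)

Lemma ae_distribution d (T : measurableType d) (R : realType)
    (P : probability T R) (X : {RV P >-> R}) (A : set R) :
  measurable A -> distribution P X A = 1 -> {ae P, forall w, A (X w)}.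
Proof.
move=> mA PA; exists (X @^-1` (~` A)); split => //.
- by rewrite -[_ @^-1` _]setTI; exact: measurable_funPT (measurableC mA).
- have : distribution P X (~` A) = 0.
    by rewrite probability_setC// [X in 1 - X]PA subee.
  by [].
Qed.

Lemma expectation_normr d (T : measurableType d) (R : realType)
    (P : probability T R) (Y : T -> R) :
    measurable_fun setT Y -> {ae P, forall w, (0 <= Y w)%R} ->
  'E_P[Y] = \int[P]_w `|Y w|%:E.
Proof.
move=> mY Y0; rewrite unlock; apply: ae_eq_integral => //.
- exact/measurable_EFinP.
- exact/measurable_EFinP/measurableT_comp.
- by apply: filterS Y0 => w Yw0 _; rewrite ger0_norm.
Qed.

(** If the integral of |Y| were 0, then Y would vanish almost surely while being almost surely
    positive, so the whole space would be negligible, against total mass 1. *)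
Lemma expectation_gt0 d (T : measurableType d) (R : realType)
    (P : probability T R) (Y : T -> R) :
    measurable_fun setT Y -> {ae P, forall w, (0 < Y w)%R} -> 0 < 'E_P[Y].
Proof.
move=> mY Y0; have Y0' : {ae P, forall w, (0 <= Y w)%R}.
  by apply: filterS Y0 => w; exact: ltW.
rewrite expectation_normr// lt_def integral_ge0 ?andbT; last first.
  by move=> w _; rewrite lee_fin.
have mY' : measurable_fun setT (EFin \o Y) by exact/measurable_EFinP.
apply/eqP => intY0.
have Y_eq0 := (ae_eq_integral_abs P measurableT mY').1 intY0.
have : {ae P, forall w : T, False}.
  apply: filterS2 Y0 Y_eq0 => w /= Yw0 /(_ I) [] Yw_eq0.
  by move: Yw0; rewrite Yw_eq0 ltxx.
case=> N [mN PN /= TN].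
have : P setT <= P N.
  by apply: le_measure => //; rewrite ?inE// => w _; exact: TN.
by rewrite probability_setT PN lee_fin ler10.
Qed.

(** * Second moment from mean and variance *)

Section second_moment.
Context d (T : measurableType d) (R : realType) (P : probability T R).
Variable X : {RV P >-> R}.
Hypotheses (X1 : P.-integrable setT (EFin \o X)) (VX : 'V_P[X] < +oo).

Lemma expectation_sqr :
  'E_P[fun w => (X w ^+ 2)%R] = 'V_P[X] + ('E_P[X] ^+ 2).
Proof.
pose m := fine 'E_P[X].
have EX : 'E_P[X] = m%:E by rewrite fineK// unlock integrable_fin_num.
have VE : 'V_P[X] = 'E_P[fun w => ((X w - m) ^+ 2)%R].
  by rewrite /variance covariance.unlock.
have X1' : (X : T -> R) \in Lfun P 1 by exact/Lfun1_integrable.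
have c1 c : (cst c : T -> R) \in Lfun P 1 by exact: Lfun_cst.
(* Integrability of the centred square is exactly finiteness of the variance. *)
have V1 : (fun w => ((X w - m) ^+ 2)%R) \in Lfun P 1.
  apply/Lfun1_integrable/integrableP; split.
    apply/measurable_EFinP/measurable_funX => //.
    exact: measurable_funB.
  move: VX; rewrite VE unlock; congr (_ < _); apply: eq_integral => w _.
  by rewrite /= ger0_norm// sqr_ge0.
(* Expanding around the mean writes X^2 as (X - m)^2 plus an affine function of X, all integrable,
   so linearity applies without first knowing that X^2 is integrable. *)
have -> : (fun w => (X w ^+ 2)%R) =
    ((fun w => ((X w - m) ^+ 2)%R) \+ ((m *+ 2) \o* X \- cst (m ^+ 2)))%R.
  by apply/funext => w /=; ring.
rewrite expectationD//; last by rewrite rpredB// Lfun_scale.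
rewrite expectationB// ?Lfun_scale// expectationZl// expectation_cst.
rewrite -VE EX; congr (_ + _).
by rewrite -EFinM -EFinB -EFin_expe; congr _%:E; ring.
Qed.

End second_moment.

(** * The length-biased law *)

Section length_biased.
Context d (T : measurableType d) d' (U : measurableType d') (R : realType).
Variables (P : probability T R) (X : {RV P >-> R}).
Variables (Q : probability U R) (Xs : {RV Q >-> R}) (m : R).
Hypotheses (X0 : {ae P, forall w, (0 <= X w)%R}) (m0 : (0 < m)%R).
Hypotheses (EX : 'E_P[X] = m%:E) (Xs_law : is_length_biased X Xs).

Let m_neq0 : m != 0%R. Proof. exact: lt0r_neq0. Qed.

(** The density is x / m; the absolute value changes it only off the almost sure range of [X] and
    makes it nonnegative everywhere, as [ge0_integral_density] requires. *)
Lemma length_biased_density (A : set R) : measurable A ->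
  distribution Q Xs A = \int[distribution P X]_(x in A) (`|x| / m)%:E.
Proof.
move=> mA; rewrite Xs_law// /length_biased_law EX inver (negbTE m_neq0).
have mXA : measurable_fun setT (fun w => (X w * \1_A (X w))%R).
  by apply: measurable_funM => //; exact: measurableT_comp.
rewrite expectation_normr//; last first.
  by apply: filterS X0 => w Xw0; rewrite mulr_ge0.
rewrite muleC -ge0_integralZl//; last 2 first.
- by apply/measurable_EFinP; exact: measurableT_comp.
- by rewrite lee_fin invr_ge0 ltW.
rewrite [RHS]integral_mkcond/= ge0_integral_distribution//; last 2 first.
- apply/(measurable_restrictT _ mA)/measurable_EFinP/measurable_funTS.
  by apply: measurable_funM => //; exact: measurableT_comp.
- move=> x; rewrite patchE; case: ifPn => // _.
  by rewrite lee_fin divr_ge0// ltW.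
apply: eq_integral => w _ /=; rewrite patchE indicE.
case: ifPn => _; first by rewrite mulr1 -EFinM mulrC.
by rewrite mulr0 normr0 mule0.
Qed.

Lemma ge0_integral_length_biased (f : R -> \bar R) :
    measurable_fun setT f -> (forall x, 0 <= f x) ->
  \int[distribution Q Xs]_x f x = \int[P]_w (f (X w) * (`|X w| / m)%:E).
Proof.
move=> mf f0; have mh : measurable_fun setT (fun x : R => (`|x| / m)%R).
  by apply: measurable_funM => //; exact: measurableT_comp.
have h0 (x : R) : (0 <= `|x| / m)%R by rewrite divr_ge0// ltW.
rewrite (ge0_integral_density mh h0 length_biased_density)//.
rewrite ge0_integral_distribution//.
- by apply: emeasurable_funM => //; exact/measurable_EFinP.
- by move=> x; rewrite mule_ge0// lee_fin.
Qed.

(** Since X >= 0 almost surely, the length-biased law gives the half-line [0, +oo[ mass E[X] / E[X]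
    = 1. *)
Lemma length_biased_ge0 : {ae Q, forall w, (0 <= Xs w)%R}.
Proof.
pose A : set R := `[0%R, +oo[%classic.
have mA : measurable A by exact: measurable_itv.
suff : distribution Q Xs A = 1.
  move=> /(ae_distribution mA); apply: filterS => w.
  by rewrite /A/= in_itv/= andbT.
rewrite Xs_law// /length_biased_law.
suff -> : 'E_P[fun w => (X w * \1_A (X w))%R] = 'E_P[X].
  by rewrite EX inver (negbTE m_neq0) -EFinM mulfV.
rewrite unlock; apply: ae_eq_integral => //.
- apply/measurable_EFinP/measurable_funM => //; exact: measurableT_comp.
- exact/measurable_EFinP.
- apply: filterS X0 => w Xw0 _; rewrite indicE mem_set ?mulr1//.
  by rewrite /A/= in_itv/= Xw0.
Qed.

Lemma expectation_length_biased :
  'E_Q[Xs] = 'E_P[fun w => (X w ^+ 2)%R] / 'E_P[X].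
Proof.
rewrite expectation_normr//; last exact: length_biased_ge0.
rewrite -(ge0_integral_distribution Xs (f := fun x => `|x|%:E))//; last first.
  by apply/measurable_EFinP; exact: normr_measurable.
rewrite ge0_integral_length_biased//; last first.
  by apply/measurable_EFinP; exact: normr_measurable.
rewrite EX inver (negbTE m_neq0) unlock muleC -ge0_integralZl//; last 3 first.
- exact/measurable_EFinP/measurable_funX.
- by move=> w _; rewrite lee_fin sqr_ge0.
- by rewrite lee_fin invr_ge0 ltW.
(* One factor |X| is the integrand and the other comes from the density; their product is X^2. *)
apply: eq_integral => w _; rewrite -!EFinM; congr _%:E.
by rewrite mulrA -expr2 real_normK ?num_real// mulrC.
Qed.

End length_biased.

(** * The mean local posterior variance *)

Lemma expectation_local_posterior_variance d (U : measurableType d)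
    (R : realType) (Q : probability U R) (Xs t : {RV Q >-> R}) :
    {ae Q, forall w, (0 <= Xs w)%R} -> is_uniform01 t ->
    independent_RV2 Xs t ->
  'E_Q[local_posterior_variance Xs t] = 'E_Q[Xs] / 6%:E.
Proof.
move=> Xs0 t_law Xs_t.
(* That t lies in [0, 1] almost surely makes t(1 - t) nonnegative there, which justifies passing to
   absolute values. *)
have t01 : {ae Q, forall w, `[0%R, 1%R]%classic (t w)}.
  apply: ae_distribution => //; rewrite t_law//.
  exact: integral_uniform_pdf1.
have mg : measurable_fun setT (fun x : R => (x * (1 - x))%R).
  by apply: measurable_funM => //; exact: measurable_funB.
rewrite expectation_normr//; last 2 first.
- apply: measurable_funM => //; exact: (measurableT_comp mg).
- apply: filterS2 Xs0 t01 => w Xsw0 /=; rewrite in_itv/= => /andP[t0 t1].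
  by rewrite /local_posterior_variance !mulr_ge0// subr_ge0.
under eq_integral do rewrite /local_posterior_variance normrM EFinM.
rewrite (ge0_integralM_independent Xs_t (f := fun x => `|x|%:E)
  (g := fun x => `|x * (1 - x)|%:E))//; last 2 first.
- by apply/measurable_EFinP; exact: normr_measurable.
- by apply/measurable_EFinP; exact: measurableT_comp.
rewrite expectation_normr// inver pnatr_eq0/=; congr (_ * _).
- rewrite ge0_integral_distribution//.
  by apply/measurable_EFinP; exact: normr_measurable.
- rewrite -integral_uniform01_bridge ge0_integral_distribution//; last first.
    by apply/measurable_EFinP; exact: measurableT_comp.
  (* [uniform_prob] is a measure on [measurableTypeR R], whose measurable sets
     are those of [R] but which is a different [measurableType]. *)
  have mt : measurable_fun setT (t : U -> measurableTypeR R).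
    exact: (@measurable_funPT _ _ _ _ t).
  pose t' := HB.pack_for {mfun U >-> measurableTypeR R}
    (t : U -> measurableTypeR R) (isMeasurableFun.Build _ _ _ _ _ mt).
  transitivity (\int[distribution Q t']_x `|x * (1 - x)|%:E).
    rewrite ge0_integral_distribution//; apply/measurable_EFinP.
    exact: measurableT_comp.
  apply: eq_measure_integral => A mA _.
  exact: t_law.
Qed.

Theorem proposition6 (R : realType)
    (d : measure_display) (T : measurableType d) (P : probability T R)
    (X : {RV P >-> R}) (lambda : R)
    (X_gt0 : distribution P X `]0%R, +oo[ = 1)
    (X_var : 'V_P[X] < +oo)
    (X_mean : 'E_P[X] = (1 / lambda)%R%:E)
    (d' : measure_display) (U : measurableType d') (Q : probability U R)
    (Xs t : {RV Q >-> R})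
    (Xs_law : is_length_biased X Xs)
    (t_law : is_uniform01 t)
    (Xs_t_indep : independent_RV2 Xs t) :
  [/\ 'E_Q[Xs] = 'E_P[(fun w => X w ^+ 2)%R] / 'E_P[X],
      'E_P[(fun w => X w ^+ 2)%R] / 'E_P[X] =
        'E_P[X] * (1 + coef_variation X ^+ 2)%R%:E,
      'E_P[X] * (1 + coef_variation X ^+ 2)%R%:E =
        ((1 + coef_variation X ^+ 2) / lambda)%R%:E,
      'E_Q[local_posterior_variance Xs t] = 'E_Q[Xs] / 6%:E &
      'E_Q[Xs] / 6%:E = ((1 + coef_variation X ^+ 2) / (6 * lambda))%R%:E].
Proof.
have Xae : {ae P, forall w, (0 < X w)%R}.
  have := ae_distribution (measurable_itv _) X_gt0; apply: filterS => w.
  by rewrite /= in_itv/= andbT.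
have X0 : {ae P, forall w, (0 <= X w)%R}.
  by apply: filterS Xae => w; exact: ltW.
(* The sign of [lambda] is deduced from the positive mean, which also excludes [lambda = 0], where
   [1 / lambda] would be 0. *)
have m0 : (0 < 1 / lambda)%R by rewrite -lte_fin -X_mean expectation_gt0.
have l0 : (0 < lambda)%R by rewrite -invr_gt0 -div1r.
(* As X is almost surely nonnegative, E|X| equals the finite mean. *)
have X1 : P.-integrable setT (EFin \o X).
  apply/integrableP; split; first exact/measurable_EFinP.
  by rewrite -expectation_normr// X_mean ltry.
have EXs := expectation_length_biased X0 m0 X_mean Xs_law.
have E2 : 'E_P[(fun w => X w ^+ 2)%R] / 'E_P[X] =
    ((1 + coef_variation X ^+ 2) / lambda)%R%:E.
  have V_fin : 'V_P[X] \is a fin_num by rewrite ge0_fin_numE// variance_ge0.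
  rewrite expectation_sqr// /coef_variation X_mean/= inver (gt_eqF m0).
  (* CV^2 becomes Var(X) / m^2 with m = 1 / [lambda], and the claim reads (Var(X) + m^2) / m = m (1
     + CV^2). *)
  rewrite expr_div_n sqr_sqrtr ?fine_ge0 ?variance_ge0//.
  rewrite -[in LHS](fineK V_fin) -EFinM; congr _%:E.
  by field; rewrite gt_eqF.
have E1 : 'E_P[X] * (1 + coef_variation X ^+ 2)%R%:E =
    ((1 + coef_variation X ^+ 2) / lambda)%R%:E.
  by rewrite X_mean -EFinM mulrC mul1r.
split => //.
- by rewrite E2 E1.
- apply: expectation_local_posterior_variance => //.
  exact: length_biased_ge0 X0 m0 X_mean Xs_law.
- rewrite EXs E2 inver pnatr_eq0/= -EFinM; congr _%:E.
  by field; rewrite gt_eqF.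
Qed.
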